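(* For every integer $n \ge 1$, $p(n) = \lceil \sqrt{8n} - 2 \rceil$.
   Context: For a family $\mathcal{S}$ of disjoint line segments in the plane, an alternating path among $\mathcal{S}$ is a simple polygonal chain in which every other segment is in $\mathcal{S}$. (Such a chain is allowed to cross segments of $\mathcal{S}$ that are not in the chain.) For $n \ge 1$, $p(n)$ is the maximum number $k$ such that any family $\mathcal{S}$ of $n$ disjoint segments in the plane, whose $2n$ endpoints are in convex position, admits an alternating path among $\mathcal{S}$ going through $k$ segments in $\mathcal{S}$. *)

(* Defs.v *)
From HB Require Import structures.
From mathcomp Require Import all_boot all_order all_algebra.
From mathcomp Require Import boolp classical_sets set_interval reals convex.

Set Implicit Arguments.
Unset Strict Implicit.
Unset Printing Implicit Defensive.

Import Order.TTheory GRing.Theory Num.Theory.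
Local Open Scope classical_set_scope.
Local Open Scope ring_scope.

Section AlternatingPaths.
Variable R : realType.

Definition plane : lmodType R := 'rV[R]_2.

Definition segment (a b : plane) : set plane :=
  [set (1 - t) *: a + t *: b | t in `[0, 1]%classic].

Definition convex_hull (A : set plane) : set plane :=
  smallest (@convex_set R plane) A.

(* Strict sense: every point is a vertex of the convex hull, so in particular
   no three points are collinear. *)
Definition convex_position (A : set plane) : Prop :=
  forall x, A x -> ~ convex_hull (A `\ x) x.

Section Family.
Variables (n : nat) (S : 'I_n -> plane * plane).

Definition member_segment (i : 'I_n) : set plane := segment (S i).1 (S i).2.

(* Segments are closed and nondegenerate, so there are exactly 2n endpoints. *)
Definition disjoint_segments : Prop :=
  (forall i, (S i).1 != (S i).2) /\ trivIset [set: 'I_n] member_segment.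

Definition endpoints : set plane :=
  [set x | exists i, x = (S i).1 \/ x = (S i).2].

(* A chain with m edges has the vertices v 0, ..., v m; the values of v beyond
   m are irrelevant. *)
Definition edge (v : nat -> plane) (i : nat) : set plane :=
  segment (v i) (v i.+1).

Definition simple_chain (m : nat) (v : nat -> plane) : Prop :=
  [/\ forall i, (i < m)%N -> v i != v i.+1,
      forall i, (i.+1 < m)%N -> edge v i `&` edge v i.+1 = [set v i.+1] &
      forall i j, (i.+1 < j)%N -> (j < m)%N -> edge v i `&` edge v j = set0].

(* An edge belongs to the family when it is one of its segments as a point
   set, whichever way it is traversed. The chain may start, and may end,
   either with a segment of the family or with a connecting edge: this is
   the choice of the parity b. *)
Definition alternating_path (m : nat) (v : nat -> plane) : Prop :=
  simple_chain m v /\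
  exists b : bool, forall i, (i < m)%N ->
    ((exists j, edge v i = member_segment j) <-> odd i = b).

Definition goes_through (m : nat) (v : nat -> plane) (k : nat) : Prop :=
  #|[set j : 'I_n |
      `[< exists2 i, (i < m)%N & edge v i = member_segment j >]]%SET| = k.

End Family.

Definition always_admits (n k : nat) : Prop :=
  forall S : 'I_n -> plane * plane,
    disjoint_segments S -> convex_position (endpoints S) ->
    exists m (v : nat -> plane), alternating_path S m v /\ goes_through S m v k.

(* is_p n k means p(n) = k, including the existence of the maximum. *)
Definition is_p (n k : nat) : Prop :=
  always_admits n k /\ forall k', always_admits n k' -> (k' <= k)%N.

End AlternatingPaths.

(* Main.v *)
Require Import Defs.
From HB Require Import structures.
From mathcomp Require Import all_boot all_order all_algebra.
From mathcomp Require Import boolp classical_sets set_interval reals convex.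
From mathcomp Require Import unstable interval_inference.
From mathcomp Require Import zify ring lra.
Import Order.TTheory GRing.Theory Num.Theory.

(** The 2n endpoints have a cyclic order, and chords joining them cross exactly
    when their ends alternate in that order; everything else is combinatorics
    of a noncrossing perfect matching of 2n points on a circle.  Call a gap
    between consecutive endpoints a leaf when its two sides are matched with
    each other, and let L be the number of leaves.

    Lower bound.  The L leaves cut the circle into arcs, so some arc has
    D >= 2n / L endpoints.  Two matched points always enclose a leaf
    ([leaf_between]), so the D endpoints of an arc lie on D different segments,
    which are nested.  Add to them the leaf segments beyond the arc, at least
    L - 2 in number.  Reading positions from the start of the arc, sort these
    M >= D + L - 2 segments by their right ends and run through
    l_1 r_1 l_2 r_2 ..., where l_i and r_i are the ends of the i-th one.  Each
    vertex then lies outside the range of all previous ones, and such a chain is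
    automatically simple ([outward_simple_chain]).  As (D + L)^2 >= 4 D L >= 8 n,
    the path visits M >= sqrt (8 n) - 2 segments
    ([matching_outward_path], [always_admits_lower]).

    Upper bound.  Take a spider: L legs side by side, each made of at most h
    nested segments.  Suppose that a path visits two segments of a leg, a and
    the deeper x.  The path cannot cross a, so the segments it visits before a
    all lie on the same side of a, and so do those visited after a.  Since x is
    inside a, either everything before a or everything after a stays in that
    leg.  Two legs cannot both be of the same one of these two kinds, so at most
    two legs are visited more than once, and the path visits at most
    L + 2 (h - 1) segments ([card_visited]).  With k = L + 2 (h - 1), a balanced
    choice of h and L makes h L equal to the integer part of (k + 2)^2 / 8
    ([spider_dimensions]).

    The two bounds meet at the k with (k + 1)^2 < 8 n <= (k + 2)^2. *)

Set Implicit Arguments.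
Unset Strict Implicit.
Unset Printing Implicit Defensive.

Local Open Scope ring_scope.

(** * Segments, orientation and convex position in the plane *)

Lemma ratio01 (R : realType) (u v : R) : 0 <= u -> 0 <= v -> 0 <= u / (u + v) <= 1.
Proof.
move=> u0 v0; have [->|nz] := eqVneq (u + v) 0; first by rewrite invr0 mulr0 lexx ler01.
have uv : 0 < u + v by rewrite lt_neqAle eq_sym nz addr_ge0.
by rewrite divr_ge0 ?addr_ge0 // ler_pdivrMr // mul1r lerDl.
Qed.

Section Plane.
Context {R : realType}.
Implicit Types (a b c d p q x y : plane R) (A B : set (plane R)).

Definition px p : R := (p : 'rV[R]_2) ord0 ord0.
Definition py p : R := (p : 'rV[R]_2) ord0 ord_max.

(** Twice the signed area of the triangle; positive for a counterclockwise one. *)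
Definition orient a b c : R :=
  (px b - px a) * (py c - py a) - (py b - py a) * (px c - px a).

Lemma plane_eq p q : px p = px q -> py p = py q -> p = q.
Proof.
move=> ex ey; apply/rowP => i.
by have [->|->] : i = ord0 \/ i = ord_max
  by case: i => [] [|[|//]] ?; [left|right]; apply/val_inj.
Qed.

Lemma segmentP a b p : segment a b p <->
  exists t : R, [/\ 0 <= t <= 1, px p = (1 - t) * px a + t * px b &
                    py p = (1 - t) * py a + t * py b].
Proof.
split=> [[t /= t01 <-]|[t [t01 ex ey]]].
  by exists t; split; [move: t01; rewrite in_itv | rewrite /px !mxE | rewrite /py !mxE].
exists t => /=; first by rewrite in_itv.
by apply: plane_eq; rewrite /px /py !mxE.
Qed.

Lemma segmentC a b : segment a b = segment b a.
Proof.
by apply/seteqP; split=> p /segmentP[t [t01 ex ey]]; apply/segmentP; exists (1 - t);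
  (split; [lra | rewrite ex; ring | rewrite ey; ring]).
Qed.

Lemma segment_left a b : segment a b a.
Proof. by apply/segmentP; exists 0; split; [lra|ring|ring]. Qed.

Lemma segment_right a b : segment a b b.
Proof. by rewrite segmentC; exact: segment_left. Qed.

Lemma segment_inj a b c d : a != b -> segment a b = segment c d ->
  (a = c /\ b = d) \/ (a = d /\ b = c).
Proof.
move=> nab e.
have /segmentP[t [/andP[t0 t1] ax ay]] : segment c d a by rewrite -e; exact: segment_left.
have /segmentP[s [/andP[s0 s1] bx b_y]] : segment c d b by rewrite -e; exact: segment_right.
have /segmentP[u [/andP[u0 u1] cx cy]] : segment a b c by rewrite e; exact: segment_left.
have /segmentP[w [/andP[w0 w1] dx dy]] : segment a b d by rewrite e; exact: segment_right.
(* Writing each segment's ends in terms of the other's shows that d - c is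
   (w - u) * (s - t) times itself, so this product is 1; as the parameters lie in [0, 1], both
   factors are 1 or both are -1. *)
have k1 : (w - u) * (s - t) = 1.
  apply/eqP/negPn/negP => k1; move/negP: nab; apply; apply/eqP.
  have hx : (1 - (w - u) * (s - t)) * (px d - px c) = 0.
    have e1 : px d - px c = (w - u) * (px b - px a) by rewrite {1}cx {1}dx; ring.
    have e2 : px b - px a = (s - t) * (px d - px c) by rewrite {1}bx {1}ax; ring.
    by rewrite mulrBl mul1r -mulrA -e2 -e1 subrr.
  have hy : (1 - (w - u) * (s - t)) * (py d - py c) = 0.
    have e1 : py d - py c = (w - u) * (py b - py a) by rewrite {1}cy {1}dy; ring.
    have e2 : py b - py a = (s - t) * (py d - py c) by rewrite {1}b_y {1}ay; ring.
    by rewrite mulrBl mul1r -mulrA -e2 -e1 subrr.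
  have nz : 1 - (w - u) * (s - t) != 0 by rewrite subr_eq0 eq_sym.
  move/eqP: hx; rewrite mulf_eq0 (negPf nz) /= subr_eq0 => /eqP hx.
  move/eqP: hy; rewrite mulf_eq0 (negPf nz) /= subr_eq0 => /eqP hy.
  by apply: plane_eq; [rewrite ax bx hx; ring | rewrite ay b_y hy; ring].
have [st|st] := lerP t s.
  have s1' : s = 1 by nra.
  have t0' : t = 0 by nra.
  by left; split; apply: plane_eq; rewrite ?ax ?ay ?bx ?b_y ?s1' ?t0'; ring.
have s1' : s = 0 by nra.
have t0' : t = 1 by nra.
by right; split; apply: plane_eq; rewrite ?ax ?ay ?bx ?b_y ?s1' ?t0'; ring.
Qed.

Lemma orientC a b c : orient a b c = orient b c a.
Proof. by rewrite /orient; ring. Qed.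

Lemma orientN a b c : orient a c b = - orient a b c.
Proof. by rewrite /orient; ring. Qed.

Lemma orient_conv a b p q x (t : R) :
  px x = (1 - t) * px p + t * px q -> py x = (1 - t) * py p + t * py q ->
  orient a b x = (1 - t) * orient a b p + t * orient a b q.
Proof. by rewrite /orient => -> ->; ring. Qed.

(** The affine form [orient a b] vanishes on the first segment and has a
    constant sign on the second. *)
Lemma same_side_disjoint a b c d : 0 < orient a b c * orient a b d ->
  (segment a b `&` segment c d)%classic = set0.
Proof.
move=> cd; apply/seteqP; split=> // x [/segmentP[t [t01 tx ty]] /segmentP[s [s01 sx sy]]] /=.
have := orient_conv a b tx ty; have := orient_conv a b sx sy.
have -> : orient a b a = 0 by rewrite /orient; ring.
have -> : orient a b b = 0 by rewrite /orient; ring.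
move: (orient a b c) (orient a b d) cd => u w uw -> /eqP; rewrite !mulr0 addr0.
have [u0|u0] := ltrP 0 u.
  have w0 : 0 < w by rewrite -(pmulr_rgt0 _ u0).
  nra.
have {}u0 : u < 0 by rewrite lt_neqAle u0 andbT; apply: contraTneq uw => ->; rewrite mul0r ltxx.
have w0 : w < 0 by rewrite -(nmulr_rgt0 _ u0).
nra.
Qed.

Lemma adjacent_segmentsI a b c : orient a b c != 0 ->
  (segment a b `&` segment b c)%classic = [set b]%classic.
Proof.
move=> nabc; apply/seteqP; split=> [x [/segmentP[t [t01 tx ty]] /segmentP[s [s01 sx sy]]]|_ ->] /=;
  last by split; [exact: segment_right|exact: segment_left].
have := orient_conv a b tx ty; have := orient_conv a b sx sy.
have -> : orient a b a = 0 by rewrite /orient; ring.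
have -> : orient a b b = 0 by rewrite /orient; ring.
move=> -> /eqP; rewrite !mulr0 !add0r mulf_eq0 (negPf nabc) orbF => /eqP s0.
by apply: plane_eq; rewrite ?sx ?sy s0; ring.
Qed.

(** The diagonals of a counterclockwise quadrilateral meet.  Each diagonal is
    cut in the ratio of the areas of the two triangles that it leaves on
    either side of the other one; the two sums of areas agree, both being the
    area of the quadrilateral. *)
Lemma diagonals_meet a b c d :
  0 < orient a b c -> 0 < orient a b d -> 0 < orient a c d -> 0 < orient b c d ->
  (segment a c `&` segment b d !=set0)%classic.
Proof.
move=> abc abd acd bcd.
have e : orient b c d + orient a b d = orient a c d + orient a b c by rewrite /orient; ring.
pose s := orient b c d + orient a b d.
have s0 : 0 < s by rewrite /s addr_gt0.
have ns : s != 0 by rewrite gt_eqF.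
pose t := orient a b d / s; pose u := orient a b c / s.
exists ((1 - t) *: a + t *: c); split.
  by exists t => //=; rewrite in_itv /= /t /s addrC ratio01 ?ltW.
have u01 : 0 <= u <= 1.
  by rewrite /u /s e addrC ratio01 ?ltW.
apply/segmentP; exists u; split=> //; rewrite /t /u.
  rewrite /px !mxE -/(px a) -/(px b) -/(px c) -/(px d).
  by move: ns; rewrite /s /orient => ns; field.
rewrite /py !mxE -/(py a) -/(py b) -/(py c) -/(py d).
by move: ns; rewrite /s /orient => ns; field.
Qed.

Lemma sub_convex_hull A x : A x -> convex_hull A x.
Proof. by move=> Ax B [_]; apply. Qed.

Lemma convex_hull_segment A a b x :
  convex_hull A a -> convex_hull A b -> segment a b x -> convex_hull A x.
Proof.
move=> Aa Ab /segmentP[t [t01 ex ey]] B [cB AB].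
have Ba := Aa _ (conj cB AB); have Bb := Ab _ (conj cB AB).
have t01' : 0 <= 1 - t <= 1 by lra.
have := cB a b (Itv01 (andP t01').1 (andP t01').2) (mem_set Ba) (mem_set Bb).
by move/set_mem; congr (B _); apply: plane_eq; rewrite ?ex ?ey /px /py /= /conv /= !mxE /onem subKr.
Qed.

(** An open half-plane is convex, so it contains the hull of its subsets. *)
Lemma convex_hull_gt0 A x (u v w : R) :
  (forall y, A y -> 0 < u * px y + v * py y + w) -> convex_hull A x ->
  0 < u * px x + v * py x + w.
Proof.
move=> Apos /(_ [set y | 0 < u * px y + v * py y + w]%classic); apply; split=> //.
move=> y z l /set_mem /= py0 /set_mem /= pz0; apply/mem_set => /=.
have /andP[l0 l1] : 0 <= l%:num <= 1 by rewrite ge0 le1.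
rewrite /px /py /conv /= !mxE /onem -!/(px _) -!/(py _).
move: (l%:num) l0 l1 => t t0 t1.
rewrite (_ : _ + w = t * (u * px y + v * py y + w) + (1 - t) * (u * px z + v * py z + w));
  last by ring.
have [->|nt] := eqVneq t 0; first by rewrite subr0 mul0r add0r mul1r.
apply: ltr_pwDl; first by rewrite mulr_gt0 // lt_neqAle eq_sym nt.
by rewrite mulr_ge0 ?subr_ge0 // ltW.
Qed.

Lemma convex_position_segment A a b x : convex_position A ->
  A a -> A b -> A x -> a != x -> b != x -> ~ segment a b x.
Proof.
move=> cA Aa Ab Ax ax bx abx; apply: (cA x Ax).
by apply: convex_hull_segment abx; apply: sub_convex_hull; split=> //=; apply/eqP.
Qed.

(** The three orientations are, up to a factor, the barycentric coordinates of
    [x] in the triangle. *)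
Lemma convex_position_triangle A a b c x : convex_position A ->
  A a -> A b -> A c -> A x ->
  0 < orient a b x -> 0 < orient b c x -> 0 < orient c a x -> False.
Proof.
move=> cA Aa Ab Ac Ax abx bcx cax.
have ax : a != x by apply: contraTneq abx => ->; rewrite -leNgt /orient; lra.
have bx : b != x by apply: contraTneq abx => ->; rewrite -leNgt /orient; lra.
have cx : c != x by apply: contraTneq bcx => ->; rewrite -leNgt /orient; lra.
apply: (cA x Ax).
pose m := orient c a x + orient b c x; pose S := m + orient a b x.
have m0 : 0 < m by rewrite /m; lra.
have S0 : 0 < S by rewrite /S; lra.
have nm : m != 0 by rewrite gt_eqF.
have nS : S != 0 by rewrite gt_eqF.
(* y is where the line through c and x leaves the triangle. *)
pose y : plane R := (1 - orient c a x / m) *: a + (orient c a x / m) *: b.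
have hA z : A z -> z != x -> convex_hull (A `\ x) z.
  by move=> Az zx; apply: sub_convex_hull; split=> //=; apply/eqP.
apply: (@convex_hull_segment _ y c); last 1 first.
- apply/segmentP; exists (orient a b x / S); split.
  + by rewrite /S addrC ratio01 ?ltW.
  + rewrite /px !mxE -/(px a) -/(px b) -/(px c) -/(px x).
    by move: nm nS; rewrite /S /m /orient => nm nS; field; rewrite nm nS.
  + rewrite /py !mxE -/(py a) -/(py b) -/(py c) -/(py x).
    by move: nm nS; rewrite /S /m /orient => nm nS; field; rewrite nm nS.
- apply: (@convex_hull_segment _ a b); [exact: hA | exact: hA |].
  by exists (orient c a x / m) => //=; rewrite in_itv /= ratio01 ?ltW.
- exact: hA.
Qed.

(** Of three collinear points, one lies between the two others. *)
Lemma convex_position_orient A a b c : convex_position A ->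
  A a -> A b -> A c -> a != b -> a != c -> b != c -> orient a b c != 0.
Proof.
move=> cA Aa Ab Ac ab ac bc; apply/eqP => abc.
have [t [tx ty]] : exists t : R,
    px c = (1 - t) * px a + t * px b /\ py c = (1 - t) * py a + t * py b.
  have [ex|nx] := eqVneq (px a) (px b); last first.
    exists ((px c - px a) / (px b - px a)).
    have nx' : px b - px a != 0 by rewrite subr_eq0 eq_sym.
    split; first by field.
    apply: (mulfI nx'); move: abc; rewrite /orient => /eqP; rewrite subr_eq0 => /eqP abc.
    rewrite -[LHS](subrK ((px b - px a) * py a)) -mulrBr abc; field.
    by [].
  have ny' : py b - py a != 0.
    by rewrite subr_eq0; apply: contra_neq ab => ey; apply: plane_eq.
  exists ((py c - py a) / (py b - py a)); split; last by field.
  apply: (mulfI ny'); move: abc; rewrite /orient => /eqP; rewrite subr_eq0 => /eqP abc.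
  rewrite -[LHS](subrK ((py b - py a) * px a)) -mulrBr -abc; field.
  by [].
have [t0|t0] := ltrP t 0.
  apply: (@convex_position_segment A c b a) => //; first by rewrite eq_sym.
    by rewrite eq_sym.
  have nt : 1 - t != 0 by apply/eqP; lra.
  apply/segmentP; exists (- t / (1 - t)); split; last 2 first.
  - by rewrite tx; field.
  - by rewrite ty; field.
  by rewrite divr_ge0 ?ler_pdivrMr; lra.
have [t1|t1] := lerP t 1.
  by apply: (@convex_position_segment A a b c) => //; apply/segmentP; exists t; rewrite t0 t1.
apply: (@convex_position_segment A a c b) => //; first by rewrite eq_sym.
have nt : t != 0 by apply/eqP; lra.
apply/segmentP; exists (1 / t); split; last 2 first.
- by rewrite tx; field.
- by rewrite ty; field.
by rewrite divr_ge0 ?ler_pdivrMr; lra.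
Qed.

End Plane.

(** * Chords of a convex polygon *)

Definition between (p q x : nat) : bool := ((p < x < q) || (q < x < p))%N.

Lemma betweenC p q : between p q =1 between q p.
Proof. by move=> x; rewrite /between orbC. Qed.

Section Ccw.
Context {R : realType}.
Variables (N : nat) (P : nat -> plane R).

Definition ccw := forall i j k, (i < j)%N -> (j < k)%N -> (k < N)%N ->
  0 < orient (P i) (P j) (P k).

Hypothesis ccwP : ccw.

(** In a convex polygon, the line through two vertices separates the vertices
    that come between them from all the others. *)
Lemma ccw_side p q x : (p < q)%N -> (q < N)%N -> (x < N)%N -> x != p -> x != q ->
  if between p q x then orient (P p) (P q) (P x) < 0 else 0 < orient (P p) (P q) (P x).
Proof.
rewrite /between => pq qN xN xp xq; case: ifP => bx.
  by rewrite orientN oppr_lt0; apply: ccwP; lia.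
have [xlt|qlt] : (x < p)%N \/ (q < x)%N by lia.
  by rewrite orientC orientC; exact: ccwP.
exact: ccwP.
Qed.

Lemma ccw_same_side p q x y : p != q -> (p < N)%N -> (q < N)%N -> (x < N)%N -> (y < N)%N ->
  x != p -> x != q -> y != p -> y != q -> between p q x = between p q y ->
  0 < orient (P p) (P q) (P x) * orient (P p) (P q) (P y).
Proof.
wlog pq : p q / (p < q)%N => [ih npq pN qN xN yN xp xq yp yq bxy|].
  have [/ih|qp|/eqP] := ltngtP p q; [exact| |by rewrite (negPf npq)].
  rewrite orientN [orient _ _ (P y)]orientN mulrNN orientC orientC.
  rewrite [orient (P p) (P y) _]orientC [orient (P y) _ _]orientC.
  by apply: ih => //; [rewrite eq_sym | rewrite !(betweenC q)].
move=> _ pN qN xN yN xp xq yp yq bxy.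
have := ccw_side pq qN xN xp xq; have := ccw_side pq qN yN yp yq; rewrite bxy.
by case: ifP => _; [by move=> y0 x0; rewrite nmulr_rgt0|by move=> y0 x0; exact: mulr_gt0].
Qed.

Lemma ccw_orient_neq0 p q x : p != q -> (p < N)%N -> (q < N)%N -> (x < N)%N ->
  x != p -> x != q -> orient (P p) (P q) (P x) != 0.
Proof.
move=> pq pN qN xN xp xq.
have := ccw_same_side pq pN qN xN xN xp xq xp xq erefl.
by apply: contraTneq => ->; rewrite mul0r ltxx.
Qed.

(** Chords whose ends alternate are the diagonals of a quadrilateral. *)
Lemma ccw_disjoint_between p q x y :
  (p < N)%N -> (q < N)%N -> (x < N)%N -> (y < N)%N ->
  (segment (P p) (P q) `&` segment (P x) (P y))%classic = set0 ->
  between p q x = between p q y.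
Proof.
move=> pN qN xN yN; wlog : p q x y pN qN xN yN / between p q x && ~~ between p q y.
  move=> ih d; case bx: (between p q x); case b_y: (between p q y) => //.
    by have := ih p q x y pN qN xN yN; rewrite bx b_y; apply.
  by have := ih p q y x pN qN yN xN; rewrite bx b_y (segmentC (P y)) => /(_ isT d).
wlog pq : p q pN qN / (p <= q)%N => [ih|].
  have [pq|/ltnW qp] := leqP p q; first exact: ih.
  by rewrite !(betweenC p) segmentC; exact: ih.
move=> /andP[bx nby] d; exfalso.
have ndisj z : segment (P p) (P q) z -> segment (P x) (P y) z -> False.
  by move=> h1 h2; have : set0 z by rewrite -d.
have npy : p != y.
  by apply/eqP => e; apply: (ndisj (P p)); [exact: segment_left|rewrite e; exact: segment_right].
have nqy : q != y.
  by apply/eqP => e; apply: (ndisj (P q)); [exact: segment_right|rewrite e; exact: segment_right].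
have meet i j k l : (i < j)%N -> (j < k)%N -> (k < l)%N -> (l < N)%N ->
  (segment (P i) (P k) `&` segment (P j) (P l) !=set0)%classic.
  by move=> ij jk kl lN; apply: diagonals_meet; apply: ccwP; lia.
have pxq : (p < x < q)%N by move: bx; rewrite /between; lia.
have [yp|py] := ltnP y p.
  have [z []] := meet y p x q yp (proj1 (andP pxq)) (proj2 (andP pxq)) qN.
  by rewrite segmentC => h1 h2; exact: (ndisj z).
have qy : (q < y)%N by move: nby; rewrite /between; lia.
have [z []] := meet p x q y (proj1 (andP pxq)) (proj2 (andP pxq)) qy yN.
exact: ndisj.
Qed.

(** Every vertex is extreme when it is reached, and the next one goes beyond
    the range again.  So a new edge either stays out of the range spanned
    before it or encloses that range: all earlier vertices but its own start
    are on one side of it. *)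
Lemma outward_simple_chain m (v : nat -> nat) :
  (forall i j, (i < j)%N -> (j < N)%N -> P i != P j) ->
  (forall j, (j <= m)%N -> (v j < N)%N) ->
  (forall j, (j <= m)%N ->
     (forall i, (i < j)%N -> (v i < v j)%N) \/ (forall i, (i < j)%N -> (v j < v i)%N)) ->
  simple_chain m (fun i => P (v i)).
Proof.
move=> injP vN out.
have dist i j : (i < j)%N -> (j <= m)%N -> v i != v j.
  by move=> ij /out[] /(_ i ij) h; rewrite neq_ltn h ?orbT.
have dist' i j : (i < j)%N -> (j <= m)%N -> v j != v i.
  by move=> ij jm; rewrite eq_sym; exact: dist.
split.
- move=> i im; have iN := vN i (ltnW im); have i1N := vN i.+1 im.
  have [h|h|/eqP] := ltngtP (v i) (v i.+1); [exact: injP|by rewrite eq_sym; exact: injP|].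
  by rewrite (negPf (dist i i.+1 _ im)).
- move=> i im; apply: adjacent_segmentsI; apply: ccw_orient_neq0.
  + by apply: dist => //; apply: ltnW.
  + by apply: vN; lia.
  + by apply: vN; lia.
  + by apply: vN; lia.
  + by apply: dist'; lia.
  + by apply: dist'; lia.
- move=> i j ij jm; rewrite setIC; apply: same_side_disjoint.
  apply: ccw_same_side; try (by apply: vN; lia); try (by apply: dist; lia).
  have h1 : (i < j)%N by lia.
  have h2 : (j <= m)%N by lia.
  have [h|h] := out j h2; have [h'|h'] := out j.+1 jm;
    have := h i h1; have := h i.+1 ij; have := h' i (leqW h1); have := h' i.+1 (leqW ij);
    have := h' j (ltnSn j); rewrite /between; lia.
Qed.

End Ccw.

(** * The cyclic order of points in convex position *)

(** Sort the other points by angle around one of them, [e x0].  Convex position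
    makes this a linear order: a failure of transitivity would put [e x0]
    inside a triangle.  A clockwise triple in the sorted list would put its
    middle point inside the triangle of [e x0] and the two others. *)
Lemma ccw_sorting (R : realType) (T : finType) (A : set (plane R)) (e : T -> plane R)
    (x0 : T) : injective e -> convex_position A -> (forall x, A (e x)) ->
  exists s : seq T, [/\ uniq s, forall x, x \in s &
                        ccw (size s) (fun i => e (nth x0 s i))].
Proof.
move=> inje cA Ae.
pose r x y := (x == y) || (0 < orient (e x0) (e x) (e y)).
pose rest := [seq x <- enum T | x != x0].
have ne x y : x != y -> e x != e y by apply: contra_neq; exact: inje.
have orient0 x y z : x != y -> x != z -> y != z -> orient (e x) (e y) (e z) != 0.
  by move=> xy xz yz; apply: convex_position_orient cA _ _ _ _ _ _ => //; exact: ne.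
have flip x y z : x != y -> x != z -> y != z ->
    ~~ (0 < orient (e x) (e y) (e z)) -> 0 < orient (e x) (e z) (e y).
  move=> xy xz yz; rewrite -leNgt le_eqVlt (negPf (orient0 _ _ _ xy xz yz)) /=.
  by rewrite [X in _ -> 0 < X]orientN oppr_gt0.
have tot : {in predC1 x0 &, total r}.
  move=> x y; rewrite !inE => x0x x0y; rewrite /r; have [//|xy] := eqVneq x y.
  by case: ltP => //=; rewrite leNgt => /flip; apply; rewrite // eq_sym.
have tr : {in predC1 x0 & &, transitive r}.
  move=> y x z; rewrite !inE => y0 x_0 z0; rewrite /r; have [-> //|xy /=] := eqVneq x y.
  have [<- pxy _|yz /= pxy pyz] := eqVneq y z; first by rewrite pxy orbT.
  have [//|xz /=] := eqVneq x z.
  case: (boolP (0 < _)) => // /flip nxz; exfalso.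
  have pzx : 0 < orient (e x0) (e z) (e x) by apply: nxz; rewrite // eq_sym.
  by apply: (convex_position_triangle cA (Ae x) (Ae y) (Ae z) (Ae x0)); rewrite orientC orientC.
have restP : all (predC1 x0) rest by apply/allP => x; rewrite mem_filter => /andP[].
have srestP : all (predC1 x0) (sort r rest) by rewrite all_sort.
have us : uniq (x0 :: sort r rest).
  rewrite /= sort_uniq filter_uniq ?enum_uniq // andbT mem_sort mem_filter eqxx //.
have pw : pairwise r (sort r rest).
  by rewrite -(sorted_pairwise_in tr srestP); exact: sort_sorted_in tot _ restP.
exists (x0 :: sort r rest); split=> //.
  move=> x; rewrite inE mem_sort mem_filter mem_enum andbT.
  by case: eqVneq.
have nn i j : (i < j)%N -> (j < size (x0 :: sort r rest))%N ->
    nth x0 (x0 :: sort r rest) i != nth x0 (x0 :: sort r rest) j.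
  by move=> ij js; rewrite nth_uniq ?neq_ltn ?ij // (ltn_trans ij).
have first j k : (0 < j)%N -> (j < k)%N -> (k < size (x0 :: sort r rest))%N ->
    0 < orient (e x0) (e (nth x0 (x0 :: sort r rest) j)) (e (nth x0 (x0 :: sort r rest) k)).
  case: j k => // j [//|k] _ jk ks.
  have := (pairwiseP x0 pw) j k; rewrite /r /= !inE => /(_ (ltn_trans jk ks) ks jk).
  by have := nn _ _ jk ks => /= /negPf ->.
move=> [|i] j k ij jk ks; first exact: first.
have pij := first i.+1 j isT ij (ltn_trans jk ks).
have pjk := first j k (ltn_trans (ltn0Sn _) ij) jk ks.
have pik := first i.+1 k isT (ltn_trans ij jk) ks.
case: (boolP (0 < _)) => // /flip nijk; exfalso.
apply: (convex_position_triangle cA (Ae x0) (Ae _) (Ae _) (Ae _) pij).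
  by apply: nijk; apply: nn => //; exact: ltn_trans jk ks || exact: ltn_trans ij jk.
by rewrite orientC.
Qed.

Lemma modn_window c i N : (0 < N)%N -> (i < N)%N ->
  ((c + i) %% N = if c %% N + i < N then c %% N + i else c %% N + i - N)%N.
Proof.
move=> N0 iN; rewrite -modnDml; have := ltn_pmod c N0; move: (c %% N)%N => a aN.
case: ltnP => h; first by rewrite modn_small.
by rewrite -[in LHS](subnK h) modnDr modn_small //; lia.
Qed.

(** The enumeration is made periodic so that any point can serve as the first
    one: every window of one period is a counterclockwise polygon. *)
Lemma cyclic_enumeration (R : realType) (T : finType) (A : set (plane R)) (e : T -> plane R)
    (x0 : T) : injective e -> convex_position A -> (forall x, A (e x)) ->
  exists Q : nat -> T,
  [/\ forall i, Q (i + #|T|)%N = Q i,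
      forall c x, exists2 i, (c <= i < c + #|T|)%N & Q i = x,
      forall i j, (i < j)%N -> (j < i + #|T|)%N -> Q i != Q j &
      forall c, ccw #|T| (fun i => e (Q (c + i)%N))].
Proof.
move=> inje cA Ae; have [s [us sT ccws]] := ccw_sorting x0 inje cA Ae.
have sN : size s = #|T|.
  by rewrite -(card_uniqP us); apply: eq_card => x; rewrite sT.
move: ccws; rewrite sN => ccws.
have N0 : (0 < #|T|)%N by apply/card_gt0P; exists x0.
exists (fun i => nth x0 s (i %% #|T|)); split.
- by move=> i; rewrite modnDr.
- move=> c x; have iN : (index x s < #|T|)%N by rewrite -sN index_mem.
  have cN := ltn_pmod c N0.
  have key j : (j < #|T|)%N -> ((c %% #|T| + j) %% #|T| = index x s)%N ->
      exists2 i, (c <= i < c + #|T|)%N & nth x0 s (i %% #|T|) = x.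
    move=> jN ej; exists (c + j)%N; first by lia.
    by rewrite -modnDml ej nth_index.
  have [h|h] := leqP (c %% #|T|) (index x s).
    by apply: (key (index x s - c %% #|T|)%N); [lia|rewrite subnKC // modn_small].
  apply: (key (index x s + #|T| - c %% #|T|)%N); first by lia.
  by rewrite subnKC; [rewrite modnDr modn_small | lia].
- move=> i j ij jN; rewrite nth_uniq ?sN ?ltn_pmod //.
  have jiN : (j - i < #|T|)%N by lia.
  rewrite -(subnKC (ltnW ij)) modn_window //.
  by have := ltn_pmod i N0; case: ifP; lia.
- move=> c i j k ij jk kN; rewrite !modn_window //; try lia.
  have := ltn_pmod c N0; move: (c %% #|T|)%N => a aN.
  case: (ltnP (a + i)%N) => hi; case: (ltnP (a + j)%N) => hj; case: (ltnP (a + k)%N) => hk;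
    try lia.
  + by apply: ccws; lia.
  + by rewrite orientC orientC; apply: ccws; lia.
  + by rewrite orientC; apply: ccws; lia.
  + by apply: ccws; lia.
Qed.

(** * Long outward paths in noncrossing matchings of a circle *)

(** Positions on the circle are natural numbers modulo [N], and [seg i] is the
    segment that ends at position [i]: each segment has exactly two ends, and
    no two of them cross. *)
Section CyclicMatching.
Local Open Scope nat_scope.
Variables (I : eqType) (N : nat) (seg : nat -> I).

Hypothesis N_gt0 : 0 < N.
Hypothesis segN : forall i, seg (i + N) = seg i.
Hypothesis partner : forall c i, c <= i < c + N ->
  exists2 j, c <= j < c + N & j != i /\ seg j = seg i.
Hypothesis thrice : forall i j k, i < j -> j < k -> k < i + N ->
  seg i = seg j -> seg j = seg k -> False.
Hypothesis noncrossing : forall i j k l, i < j -> j < k -> k < l -> l < i + N ->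
  seg i = seg k -> seg j = seg l -> False.

Lemma thrice_window c i j k : c <= i < c + N -> c <= j < c + N -> c <= k < c + N ->
  i != j -> i != k -> j != k -> seg i = seg j -> seg i = seg k -> False.
Proof.
wlog ij : i j / i < j => [hw iN jN kN nij ik jk eij eik|].
  by have := nij; rewrite neq_ltn => /orP[h|h]; [apply: (hw i j)|apply: (hw j i)];
    rewrite // ?(eq_sym j) // -eij.
move=> /andP[ci iN] /andP[cj jN] /andP[ck kN] _ ik jk eij eik.
have [ki|ki] := ltnP k i; first by apply: (@thrice k i j) => //; lia.
have [kj|kj] := ltnP k j; first by apply: (@thrice i k j) => //; [lia|lia|congruence].
by apply: (@thrice i j k) => //; [lia|lia|congruence].
Qed.

Definition leaf i : bool := seg i == seg i.+1.

(** The partner of [i.+1] is caught between [i] and [j], so the interval can be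
    shrunk until its ends are adjacent. *)
Lemma leaf_between i j : i < j -> j < i + N -> seg i = seg j ->
  exists2 g, i <= g < j & leaf g.
Proof.
have [m] := ubnP (j - i); elim: m i j => // m IH i j jim ij jN eij.
have [e1|ne1] := eqVneq (seg i) (seg i.+1); first by exists i; rewrite ?leqnn //; apply/eqP.
have i1j : i.+1 < j.
  by rewrite ltn_neqAle ij andbT; apply: contra_neq ne1 => ->.
have [k kN [nk ek]] := @partner i i.+1 ltac:(lia).
have kj : k < j.
  rewrite ltnNge leq_eqVlt; apply/negP => /orP[/eqP jk|jk].
    by move: ne1; rewrite eij jk ek eqxx.
  by apply: (@noncrossing i i.+1 j k) => //; lia.
have nki : k != i by apply: contra_neq ne1 => ki; rewrite -ek ki.
have i1k : i.+1 < k by lia.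
have [g gk lg] := IH i.+1 k ltac:(lia) i1k ltac:(lia) (esym ek).
by exists g => //; lia.
Qed.

Definition leaves := \sum_(0 <= i < N) leaf i.

Lemma leafN i : leaf (i + N) = leaf i.
Proof. by rewrite /leaf -addSn !segN. Qed.

Lemma leaves_shift c : \sum_(c <= i < c + N) leaf i = leaves.
Proof.
elim: c => [//|c <-].
have cN : c < c + N by lia.
by rewrite addSn big_nat_recr //= leafN [RHS]big_ltn // addnC.
Qed.

(** Double counting of the pairs of a window and a leaf in it: up to rotation
    there are [N] windows of length [d], each with at least one leaf, and each
    leaf lies in [d] of them. *)
Lemma leaves_cover d : (forall i, exists2 g, i <= g < i + d & leaf g) -> N <= leaves * d.
Proof.
move=> cover; have <- : \sum_(0 <= t < d) \sum_(0 <= i < N) leaf (i + t) = leaves * d.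
  rewrite (eq_big_nat _ _ (F2 := fun=> leaves)); first by rewrite sum_nat_const_nat mulnC subn0.
  move=> t _; rewrite -(leaves_shift t).
  have := @big_addn nat 0 addn 0 (t + N) t xpredT (fun i => leaf i : nat).
  by rewrite add0n addKn.
rewrite exchange_big /= -{1}[N]subn0 -[X in X <= _]muln1 -sum_nat_const_nat.
apply: leq_sum => i _; have [g /andP[ig gd] lg] := cover i.
have gi : g - i < d by lia.
rewrite (big_cat_nat (n := g - i)) //=; last exact: ltnW.
by rewrite [X in _ + X]big_ltn // subnKC // lg; lia.
Qed.

(** Take [d.+1] minimal such that every window of that many gaps contains a
    leaf.  The positions [c, ..., c + d] then form an arc of [d.+1] endpoints
    without a leaf inside. *)
Lemma long_leafless_arc : exists c d,
  (forall g, c <= g < c + d -> ~~ leaf g) /\ N <= leaves * d.+1.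
Proof.
pose cover d := forall i, exists2 g, i <= g < i + d & leaf g.
have coverN : cover N.
  move=> i; have [j jN [nj ej]] := @partner i i ltac:(lia).
  have [g gj lg] := @leaf_between i j ltac:(lia) ltac:(lia) (esym ej).
  by exists g => //; lia.
suff [d [/existsNP[c nc] covd]] : exists d, ~ cover d /\ cover d.+1.
  exists c, d; split; last exact: leaves_cover.
  by move=> g gd; apply/negP => lg; apply: nc; exists g.
have ncover0 : ~ cover 0 by move=> /(_ 0)[g]; lia.
elim: {1}N coverN ncover0 => [//|m IH] cm nc0.
by have [/IH|nm] := pselect (cover m); [apply|exists m].
Qed.

(** The path visits the segments [seg (c + w t.*2)], [t < M], entering at the
    even vertex [w t.*2] and leaving at the next one.  Positions are relative
    to [c], the start of a long arc without leaves. *)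
Lemma matching_outward_path : exists c M (w : nat -> nat), 4 * N <= (M + 2) ^ 2 /\
  [/\ forall j, j < M.*2 -> w j < N,
      forall j, j < M.*2 -> (forall i, i < j -> w i < w j) \/ (forall i, i < j -> w j < w i),
      forall t, t < M -> seg (c + w t.*2) = seg (c + w t.*2.+1) &
      forall s t, s < t -> t < M -> seg (c + w s.*2) != seg (c + w t.*2)].
Proof.
have [c [d [noleaf covN]]] := long_leafless_arc.
(* p i is the other end, within the window starting at c, of the segment
   ending at i. *)
have /choice[p pP] i : exists j, c <= i < c + N -> [/\ c <= j < c + N, j != i & seg j = seg i].
  have [iN|_] := boolP (c <= i < c + N); last by exists 0.
  by have [j jN [nj ej]] := @partner c i iN; exists j.
have p_uniq i j : c <= i < c + N -> c <= j < c + N -> i != j -> seg i = seg j -> p i = j.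
  move=> iN jN nij eij; have [piN npi epi] := pP i iN.
  apply/eqP; apply/negPn/negP => npj.
  by apply: (thrice_window iN jN piN); rewrite ?epi // eq_sym.
have arc_distinct i j : c <= i -> i < j -> j < c + d.+1 -> j < i + N -> seg i != seg j.
  move=> ci ij jd jN; apply/eqP => eij; have [g gij lg] := leaf_between ij jN eij.
  by have := noleaf g ltac:(lia); rewrite lg.
have pN i : c <= i < c + N -> c <= p i < c + N by move=> /pP[].
have pn i : c <= i < c + N -> p i != i by move=> /pP[].
have segp i : c <= i < c + N -> seg (p i) = seg i by move=> /pP[].
have pK i : c <= i < c + N -> p (p i) = i.
  by move=> iN; apply: p_uniq => //; [exact: pN|exact: pn|exact: segp].
have dN : d.+1 < N.
  rewrite ltnNge; apply/negP => Nd.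
  have cN : c <= c < c + N by lia.
  have := pn c cN; have := pN c cN; have := segp c cN => ec pcN pcc.
  by have := arc_distinct c (p c) ltac:(lia) ltac:(lia) ltac:(lia) ltac:(lia); rewrite ec eqxx.
have parc i : c <= i < c + d.+1 -> c + d.+1 <= p i.
  move=> id; have iN : c <= i < c + N by lia.
  have := pN i iN; have := pn i iN; have := segp i iN => ei nei piN.
  rewrite leqNgt; apply/negP => pid.
  have [lt|lt|eq] := ltngtP i (p i).
  - by have := arc_distinct i (p i) ltac:(lia) ltac:(lia) ltac:(lia) ltac:(lia); rewrite ei eqxx.
  - by have := arc_distinct (p i) i ltac:(lia) ltac:(lia) ltac:(lia) ltac:(lia); rewrite ei eqxx.
  - by move: nei; rewrite -eq eqxx.
(* The right ends of the segments issuing from the arc, and those of the leaf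
   segments that avoid the arc. *)
pose ends := [seq p i | i <- iota c d.+1].
pose tips := [seq g.+1 | g <- iota (c + d.+1) (N - d.+2) & leaf g].
pose rs := sort leq (ends ++ tips).
have tipP r : r \in tips -> [/\ c + d.+1 < r, r < c + N & p r = r.-1].
  move=> /mapP[g]; rewrite mem_filter mem_iota => /andP[lg gN] ->.
  split; [lia|lia|apply: p_uniq; [lia|lia| |exact/esym/eqP]].
  by rewrite eqn_leq ltnn.
have endP r : r \in ends -> [/\ c + d.+1 <= r, r < c + N & p r < c + d.+1].
  move=> /mapP[i]; rewrite mem_iota => iN ->.
  have iN' : c <= i < c + N by lia.
  by rewrite pK //; have := parc i iN; have := pN i iN'; split; lia.
have rsP r : r \in rs -> [/\ c + d.+1 <= r, r < c + N, p r < r & p r = r.-1 \/ p r < c + d.+1].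
  rewrite mem_sort mem_cat => /orP[/endP|/tipP] [h1 h2 h3].
    by split=> //; [lia|right].
  by split=> //; [lia|lia|left].
have p_inj i j : c <= i < c + N -> c <= j < c + N -> p i = p j -> i = j.
  by move=> iN jN e; rewrite -(pK i iN) e pK.
have urs : uniq rs.
  rewrite sort_uniq cat_uniq; apply/and3P; split.
  - rewrite map_inj_in_uniq ?iota_uniq // => i j; rewrite !mem_iota => iN jN.
    by apply: p_inj; lia.
  - apply/hasPn => r rt; apply/negP => /endP[h1 h2 h3]; have [h4 h5 h6] := tipP r rt; lia.
  - by rewrite map_inj_uniq ?filter_uniq ?iota_uniq // => i j [].
have srs : sorted ltn rs by rewrite ltn_sorted_uniq_leq urs (sort_sorted leq_total).
have size_tips : leaves <= size tips + 2.
  have count_sum s : count leaf s = \sum_(g <- s) leaf g by rewrite -sum1_count big_mkcond.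
  have arc0 : \sum_(c + N <= g < c + N + d) leaf g = 0.
    rewrite big_nat big1 // => g gN; have := noleaf (g - N) ltac:(lia).
    by rewrite -(leafN (g - N)) subnK; [move/negPf->|lia].
  (* Among the N gaps from c + d.+1 on, those not counted in tips are the ones
     inside the arc, which are no leaves, and the two at its ends. *)
  rewrite size_map size_filter count_sum -(leaves_shift (c + d.+1)).
  rewrite (big_cat_nat (n := c + N.-1)) /=; [|lia|lia].
  rewrite (big_cat_nat (n := c + N) (m := c + N.-1)) /=; [|lia|lia].
  rewrite (big_cat_nat (n := c + N + d) (m := c + N)) /=; [|lia|lia].
  rewrite arc0 add0n.
  have one a b : b = a.+1 -> \sum_(a <= i < b) leaf i <= 1.
    by move=> ->; rewrite big_nat1; case: leaf.
  apply: leq_add; last by apply: (@leq_add _ _ 1 1); apply: one; lia.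
  rewrite /index_iota (_ : c + N.-1 - (c + d.+1) = N - d.+2); last by lia.
  by apply: leq_sum => i _; case: leaf.
have size_rs : d.+1 + leaves <= size rs + 2.
  by rewrite size_sort size_cat size_map size_iota -addnA leq_add2l.
pose r t := nth 0 rs t; pose M := size rs.
have rM t : t < M -> r t \in rs by exact: mem_nth.
have r_lt s t : s < t -> t < M -> r s < r t.
  by move=> st tM; apply: (sorted_ltn_nth ltn_trans) => //; rewrite inE // (ltn_trans st).
have rN t : t < M -> c <= r t < c + N by move=> /rM/rsP[] *; lia.
(* A leaf segment lies to the right of everything before it; a segment
   issuing from the arc encloses everything before it. *)
have l_r t : t < M ->
    (forall s, s < t -> r s < p (r t)) \/ (forall s, s < t -> p (r t) < p (r s)).
  move=> tM; have [h1' h2' h3' [h4'|h4']] := rsP _ (rM _ tM); [left|right] => s st;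
    have sM := ltn_trans st tM; have rst := r_lt s t st tM; have [h1 h2 h3 h4] := rsP _ (rM _ sM).
    rewrite ltn_neqAle; apply/andP; split; last by lia.
    apply/eqP => e; have := pK _ (rN t tM); rewrite -e => e'; lia.
  rewrite ltnNge leq_eqVlt; apply/negP => /orP[/eqP e|lt].
    by have := p_inj _ _ (rN s sM) (rN t tM) e; lia.
  apply: (@noncrossing (p (r s)) (p (r t)) (r s) (r t)) => //.
  - lia.
  - have := pN _ (rN s sM); lia.
  - by rewrite segp ?rN.
  - by rewrite segp ?rN.
exists c, M, (fun j => (if odd j then r j./2 else p (r j./2)) - c); split.
  apply: leq_trans (leq_trans (nat_AGM2 d.+1 leaves) _); first by rewrite leq_mul2l mulnC.
  by rewrite leq_sqr.
have half j : j < M.*2 -> j./2 < M by lia.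
have key j : j < M.*2 -> c <= (if odd j then r j./2 else p (r j./2)) < c + N.
  move=> /half jM; have := rN _ jM; have := pN _ (rN _ jM); case: odd => //.
have seg_r t : t < M -> seg (p (r t)) = seg (r t) by move=> /rN/segp.
split.
- by move=> j /key; lia.
- move=> j jM; have jM2 := half j jM.
  suff [h|h] : (forall i, i < j ->
      (if odd i then r i./2 else p (r i./2)) < (if odd j then r j./2 else p (r j./2)))
    \/ (forall i, i < j ->
      (if odd j then r j./2 else p (r j./2)) < (if odd i then r i./2 else p (r i./2))).
  + by left=> i ij; have := h i ij; have := key i (ltn_trans ij jM); have := key j jM; lia.
  + by right=> i ij; have := h i ij; have := key i (ltn_trans ij jM); have := key j jM; lia.
  have p_r u : u < M -> p (r u) < r u by move=> /rM/rsP[].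
  have lr_le i : i./2 < M -> (if odd i then r i./2 else p (r i./2)) <= r i./2.
    by move=> iM; case: odd => //; apply/ltnW/p_r.
  case: (boolP (odd j)) => oj.
    left=> i ij; have [e|ne] := eqVneq i./2 j./2.
      by rewrite e (_ : odd i = false) ?p_r //; lia.
    by apply: leq_ltn_trans (lr_le i _) _; [|apply: r_lt]; lia.
  have [h|h] := l_r _ jM2; [left|right] => i ij; last first.
    have ij2 : i./2 < j./2 by lia.
    have := h _ ij2; have := p_r i./2 ltac:(lia); case: odd => //; lia.
  have ij2 : i./2 < j./2 by lia.
  by apply: leq_ltn_trans (lr_le i _) (h _ ij2); lia.
- move=> t tM; rewrite /= odd_double doubleK /= uphalf_double.
  by rewrite !subnKC ?seg_r //; [have := rN _ tM|have := pN _ (rN _ tM)]; lia.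
- move=> s t st tM; have sM := ltn_trans st tM; rewrite !odd_double !doubleK /=.
  rewrite !subnKC ?seg_r //; last 2 first.
    by have := pN _ (rN _ sM); have := pN _ (rN _ tM); lia.
    by have := pN _ (rN _ sM); have := pN _ (rN _ tM); lia.
  apply/eqP => e; have := p_uniq _ _ (rN _ sM) (rN _ tM) _ e.
  have := r_lt s t st tM; have [_ _ h _] := rsP _ (rM _ sM) => lt.
  by rewrite ltn_eqF // => /(_ isT); lia.
Qed.

End CyclicMatching.

(** * Every family admits a long path *)

Section Family.
Context {R : realType} {n : nat}.
Variable S : 'I_n -> plane R * plane R.

(** Indexing the endpoints by a finite type with 2n elements lets them be
    sorted together with the segment to which each belongs. *)
Definition endpoint (x : 'I_n * bool) : plane R := if x.2 then (S x.1).1 else (S x.1).2.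

Hypothesis disjS : disjoint_segments S.

Lemma member_segment_endpoint x : member_segment S x.1 (endpoint x).
Proof. by case: x => i [] /=; [exact: segment_left|exact: segment_right]. Qed.

Lemma member_segment_eq i j p : member_segment S i p -> member_segment S j p -> i = j.
Proof. by move=> ip jp; apply: disjS.2 => //; exists p. Qed.

Lemma endpoint_inj : injective endpoint.
Proof.
move=> x y e; have exy : x.1 = y.1.
  apply: (member_segment_eq (member_segment_endpoint x)).
  by rewrite e; exact: member_segment_endpoint.
move: x y exy e => [i a] [j b] /= <-{j}; have := disjS.1 i; rewrite /endpoint /=.
by case: a; case: b => //= nd e; move: nd; rewrite e eqxx.
Qed.

Lemma endpoints_endpoint x : endpoints S (endpoint x).
Proof. by case: x => i []; exists i; [left|right]. Qed.

Lemma segment_endpoint x y : x.1 = y.1 -> x != y ->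
  segment (endpoint x) (endpoint y) = member_segment S x.1.
Proof.
case: x y => [i a] [j b] /= <-{j}; rewrite /endpoint /=.
by case: a; case: b; rewrite ?eqxx // => _; rewrite segmentC.
Qed.

End Family.

Lemma always_admits_lower (R : realType) (n k : nat) : (0 < n)%N ->
  ((k + 1) ^ 2 < 8 * n)%N -> always_admits R n k.
Proof.
move=> n0 kn S disjS cS; have x0 : 'I_n * bool := (Ordinal n0, true).
have [Q [QN Qsurj Qinj Qccw]] :=
  cyclic_enumeration x0 (endpoint_inj disjS) cS (endpoints_endpoint S).
have cardN : #|{: 'I_n * bool}| = n.*2 by rewrite card_prod card_ord card_bool muln2.
rewrite cardN in QN Qsurj Qinj Qccw.
have [c [M [w [MN [wN wout wseg wdist]]]]] : exists c M (w : nat -> nat),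
    (4 * n.*2 <= (M + 2) ^ 2)%N /\
  [/\ forall j, (j < M.*2 -> w j < n.*2)%N,
      forall j, (j < M.*2)%N ->
        (forall i, (i < j)%N -> (w i < w j)%N) \/ (forall i, (i < j)%N -> (w j < w i)%N),
      forall t, (t < M)%N -> (Q (c + w t.*2)%N).1 = (Q (c + w t.*2.+1)%N).1 &
      forall s t, (s < t)%N -> (t < M)%N -> (Q (c + w s.*2)%N).1 != (Q (c + w t.*2)%N).1].
  apply: (@matching_outward_path _ _ (fun i => (Q i).1)).
  - by rewrite double_gt0.
  - by move=> i; rewrite QN.
  - move=> c i iN; have [j jN ej] := Qsurj c ((Q i).1, ~~ (Q i).2).
    exists j => //; rewrite ej; split=> //.
    by apply/eqP => e; move: ej; rewrite e; case: (Q i) => a [].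
  - move=> i j k' ij jk ki eij ejk.
    have nij := Qinj i j ij ltac:(lia); have njk := Qinj j k' jk ltac:(lia).
    have nik := Qinj i k' ltac:(lia) ki.
    move: eij ejk nij njk nik; case: (Q i) (Q j) (Q k') => [a b] [a' b'] [a'' b''] /= <- <-.
    by rewrite !xpair_eqE !eqxx /=; case: b; case: b'; case: b''.
  - move=> i j k' l ij jk kl li eik ejl.
    have ccwi := Qccw i.
    have [z [z1 z2]] : (segment (endpoint S (Q i)) (endpoint S (Q k')) `&`
       segment (endpoint S (Q j)) (endpoint S (Q l)) !=set0)%classic.
      have sh x : (i <= x)%N -> Q x = Q (i + (x - i))%N by move=> ix; rewrite subnKC.
      rewrite (sh i) // (sh j) ?(sh k') ?(sh l); try lia.
      by apply: diagonals_meet; apply: ccwi; lia.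
    rewrite segment_endpoint // in z1; last by apply: Qinj; lia.
    rewrite segment_endpoint // in z2; last by apply: Qinj; lia.
    have eij := member_segment_eq disjS z1 z2.
    have nij := Qinj i j ij ltac:(lia); have nik := Qinj i k' ltac:(lia) ltac:(lia).
    have njk := Qinj j k' jk ltac:(lia).
    move: eij eik nij nik njk; case: (Q i) (Q j) (Q k') => [a b] [a' b'] [a'' b''] /= <- <-.
    by rewrite !xpair_eqE !eqxx /=; case: b; case: b'; case: b''.
(* (M + 2)^2 >= 8 n > (k + 1)^2; the path is cut after its k-th segment, that
   is, after 2 k - 1 edges. *)
have kM : (k <= M)%N by nia.
have M0 : (0 < M)%N by nia.
pose v j : plane R := endpoint S (Q (c + w j)%N).
have vM j : (j <= k.*2.-1)%N -> (j < M.*2)%N by lia.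
have member_even t : (t < M)%N -> edge v t.*2 = member_segment S (Q (c + w t.*2)%N).1.
  move=> tM; apply: segment_endpoint; first exact: wseg.
  have h1 := wN t.*2 ltac:(lia); have h2 := wN t.*2.+1 ltac:(lia).
  have [/(_ t.*2 (ltnSn _)) h|/(_ t.*2 (ltnSn _)) h] := wout t.*2.+1 ltac:(lia).
    by apply: Qinj; lia.
  by rewrite eq_sym; apply: Qinj; lia.
(* A connecting edge meets two different segments of the family, so it is not
   one of them. *)
have not_odd t j : (t.+1 < M)%N -> edge v t.*2.+1 = member_segment S j -> False.
  move=> tM e.
  have ej1 : j = (Q (c + w t.*2.+1)%N).1.
    apply: (member_segment_eq disjS (p := v t.*2.+1)); first by rewrite -e; exact: segment_left.
    exact: member_segment_endpoint.
  have ej2 : j = (Q (c + w t.+1.*2)%N).1.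
    apply: (member_segment_eq disjS (p := v t.+1.*2)); first by rewrite -e; exact: segment_right.
    exact: member_segment_endpoint.
  by have := wdist t t.+1 (ltnSn t) tM; rewrite wseg -?ej1 -?ej2 ?eqxx //; exact: ltnW.
exists k.*2.-1, v; split; first split.
- apply: (outward_simple_chain (Qccw c)).
  + move=> i j ij jN; apply: contra_neq (Qinj (c + i)%N (c + j)%N ltac:(lia) ltac:(lia)).
    exact: endpoint_inj.
  + by move=> j /vM; exact: wN.
  + by move=> j /vM; exact: wout.
- exists false => i im; split.
    case: (boolP (odd i)) => // oi [j]; rewrite -[i]odd_double_half oi => /not_odd.
    by case; lia.
  move=> /negbT oi; exists (Q (c + w i)%N).1.
  by rewrite -[in LHS](even_halfK oi) member_even ?even_halfK //; lia.
rewrite /goes_through -[RHS](card_ord k).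
rewrite -[RHS](card_imset _ (f := fun t : 'I_k => (Q (c + w t.*2)%N).1)); last first.
  move=> s t /= est; apply/val_inj => /=.
  have sM := leq_trans (ltn_ord s) kM; have tM := leq_trans (ltn_ord t) kM.
  have [h|h|//] := ltngtP (s : nat) t.
    by have := wdist s t h tM; rewrite est eqxx.
  by have := wdist t s h sM; rewrite est eqxx.
apply: eq_card => j; rewrite inE; apply/asboolP/imsetP.
  move=> [i im]; rewrite -[i]odd_double_half; case: (boolP (odd i)) => oi /=.
    by move=> /not_odd[]; lia.
  have ik : (i./2 < k)%N by lia.
  rewrite add0n member_even; last by lia.
  move=> e; exists (Ordinal ik) => //=; symmetry.
  apply: (member_segment_eq disjS (p := v i./2.*2)); first exact: member_segment_endpoint.
  by rewrite -e; exact: member_segment_endpoint.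
move=> [t _ ->]; have tk := ltn_ord t; exists t.*2; first by lia.
by rewrite member_even //; lia.
Qed.

(** * Points on a parabola *)

Section Parabola.
Variable R : realType.

Definition parabola (x : nat) : plane R := (\row_(i < 2) x%:R ^+ i.+1)%R.

Lemma px_parabola x : px (parabola x) = x%:R.
Proof. by rewrite /px mxE expr1. Qed.

Lemma py_parabola x : py (parabola x) = x%:R ^+ 2.
Proof. by rewrite /py mxE. Qed.

Lemma parabola_inj : injective parabola.
Proof. by move=> x y /(congr1 px); rewrite !px_parabola => /eqP; rewrite eqr_nat => /eqP. Qed.

Lemma ccw_parabola N : ccw N parabola.
Proof.
move=> i j k ij jk _; rewrite /orient !px_parabola !py_parabola.
rewrite (_ : _ - _ = (j%:R - i%:R) * (k%:R - i%:R) * (k%:R - j%:R)); last by ring.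
by rewrite !mulr_gt0 // subr_gt0 ltr_nat // (ltn_trans ij).
Qed.

(** Each point of the parabola is alone on the tangent there, and the others
    are all above it. *)
Lemma convex_position_parabola (A : set (plane R)) :
  (forall p, A p -> exists x, p = parabola x) -> convex_position A.
Proof.
move=> Apar p Ap hp; have [x ep] := Apar p Ap.
suff key q : (A `\ p)%classic q -> 0 < - 2 * x%:R * px q + 1 * py q + x%:R ^+ 2.
  have := convex_hull_gt0 key hp; rewrite ep px_parabola py_parabola.
  by rewrite (_ : _ + _ + _ = 0) ?ltxx //; ring.
move=> [Aq qp]; have [y eq] := Apar q Aq; rewrite eq px_parabola py_parabola.
rewrite (_ : _ + _ + _ = (y%:R - x%:R) ^+ 2); last by ring.
rewrite exprn_even_gt0 //= subr_eq0 eqr_nat; apply/eqP => yx.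
by apply: qp; rewrite /= ep eq yx.
Qed.

End Parabola.

(** * Paths among the legs of a spider *)

(** Segment [j] belongs to leg [j %/ h], at depth [j %% h] in it; each leg has
    [2 * h] consecutive positions of its own. *)
Section Spider.
Variables (R : realType) (n h : nat).
Hypothesis h_gt0 : (0 < h)%N.
Implicit Types (j a x : 'I_n).

Definition lo j : nat := 2 * h * (j %/ h) + j %% h.
Definition hi j : nat := 2 * h * (j %/ h) + (2 * h - 1 - j %% h).
Definition spider j : plane R * plane R := (parabola R (lo j), parabola R (hi j)).
Definition inside a x : bool := between (lo a) (hi a) (lo x).

Lemma same_leg a x : (a %/ h = x %/ h)%N -> a != x -> (a %% h != x %% h)%N.
Proof.
move=> e; apply: contra_neq => e'; apply/val_inj => /=.
by rewrite (divn_eq a h) e e' -divn_eq.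
Qed.

Lemma legs_apart a x : (a %/ h < x %/ h)%N -> (hi a < lo x)%N.
Proof.
rewrite /hi /lo => ax; have := ltn_pmod a h_gt0.
have := leq_mul (leqnn (2 * h)) ax; lia.
Qed.

Lemma lo_hi a : (lo a < hi a)%N.
Proof. by have := ltn_pmod a h_gt0; rewrite /lo /hi; lia. Qed.

Lemma inside_leg a x : inside a x -> (x %/ h = a %/ h)%N.
Proof.
rewrite /inside /between; have := lo_hi a; have := lo_hi x.
by have [/legs_apart|/legs_apart|//] := ltngtP (x %/ h)%N (a %/ h)%N; lia.
Qed.

Lemma inside_depth a x : (a %/ h = x %/ h)%N -> (a %% h < x %% h)%N -> inside a x.
Proof.
rewrite /inside /between /lo /hi => <-.
by have := ltn_pmod a h_gt0; have := ltn_pmod x h_gt0; lia.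
Qed.

Lemma spider_laminar a x : a != x ->
  [/\ lo x != lo a, lo x != hi a, hi x != lo a, hi x != hi a &
      inside a x = between (lo a) (hi a) (hi x)].
Proof.
rewrite /inside /between => ax; have := lo_hi a; have := lo_hi x.
have [/legs_apart|/legs_apart|e] := ltngtP (x %/ h)%N (a %/ h)%N; try (split; lia).
have := same_leg (esym e) ax; have := ltn_pmod a h_gt0; have := ltn_pmod x h_gt0.
by rewrite /lo /hi e; split; lia.
Qed.

Lemma spider_disjoint : disjoint_segments spider.
Proof.
split=> [j|a x _ _ [p [pa px]]].
  by apply/eqP => /parabola_inj; have := lo_hi j; lia.
apply/eqP/negPn/negP => ax; have [h1 h2 h3 h4 h5] := spider_laminar ax.
have : set0 p; last by [].
rewrite -(@same_side_disjoint _ _ _ _ _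
  (ccw_same_side (@ccw_parabola R (lo a + hi a + lo x + hi x).+1) _ _ _ _ _ h1 h2 h3 h4 h5)) //;
  try lia.
by have := lo_hi a; lia.
Qed.

Lemma spider_convex : convex_position (endpoints spider).
Proof.
by apply: convex_position_parabola => p [j [->|->]]; [exists (lo j)|exists (hi j)].
Qed.

Section Path.
Variables (m : nat) (v : nat -> plane R) (b : bool).
Hypothesis chain_v : simple_chain m v.
Hypothesis alt_v : forall i, (i < m)%N ->
  ((exists j, edge v i = member_segment spider j) <-> odd i = b).

Definition visits (i : nat) j := (i < m)%N /\ edge v i = member_segment spider j.

Lemma visits_odd i j : visits i j -> odd i = b.
Proof. by move=> [im e]; apply/(alt_v im); exists j. Qed.

Lemma visits_uniq i i' j : visits i j -> visits i' j -> i = i'.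
Proof.
wlog ii : i i' / (i < i')%N => [ih vi vi'|vi vi'].
  by have [lt|lt|//] := ltngtP i i'; [|symmetry]; apply: ih.
have [_ _ dis] := chain_v; have o := visits_odd vi; have o' := visits_odd vi'.
have : set0 (v i); last by [].
rewrite -(dis i i'); [|lia|exact: vi'.1].
by split; last rewrite /= vi'.2 -vi.2; exact: segment_left.
Qed.

Lemma visits_vertex i j : visits i j ->
  exists z z', [/\ v i = parabola R z, v i.+1 = parabola R z' & z \in [:: lo j; hi j]].
Proof.
case=> im e; have nv : v i != v i.+1 by case: chain_v => + _ _; apply.
by have [[-> ->]|[-> ->]] := segment_inj nv e; [exists (lo j), (hi j)|exists (hi j), (lo j)];
  rewrite !inE eqxx ?orbT.
Qed.

(** A walk along the parabola whose edges avoid a segment cannot pass from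
    inside that segment to its outside. *)
Lemma walk_side a q1 q2 (x y : nat) : (q1 <= q2)%N ->
  (forall q, (q1 <= q < q2)%N ->
     (member_segment spider a `&` edge v q)%classic = set0) ->
  (forall q, (q1 <= q <= q2)%N -> exists z, v q = parabola R z) ->
  v q1 = parabola R x -> v q2 = parabola R y ->
  between (lo a) (hi a) x = between (lo a) (hi a) y.
Proof.
elim: q2 y => [|q2 IH] y.
  by rewrite leqn0 => /eqP-> _ _ -> /parabola_inj->.
rewrite leq_eqVlt => /orP[/eqP-> _ _ -> /parabola_inj->//|q12 dis par vx vy].
have [z vz] := par q2 ltac:(lia).
rewrite (IH z) //; [| move=> q qq; apply: dis; lia | move=> q qq; apply: par; lia].
apply: (ccw_disjoint_between (@ccw_parabola R (lo a + hi a + z + y).+1)); try lia.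
by rewrite -vz -vy; apply: dis; lia.
Qed.

(** Only the edges next to edge [i] may touch it, and these do not lie between
    two visits on the same side of [i], because visits occur at every other
    edge. *)
Lemma one_side i a i1 x i2 y : visits i a -> visits i1 x -> visits i2 y ->
  (i1 < i)%N && (i2 < i)%N || (i < i1)%N && (i < i2)%N -> inside a x = inside a y.
Proof.
wlog le12 : i1 x i2 y / (i1 <= i2)%N => [ih va vx vy ii|].
  have [le|/ltnW le] := leqP i1 i2; first exact: (ih i1 x i2 y).
  by symmetry; apply: (ih i2 y i1 x) => //; rewrite !(andbC (i2 < _)%N, andbC (i < i2)%N).
move=> va vx vy side.
have := visits_odd va; have := visits_odd vx; have := visits_odd vy => o2 o1 o0.
have ends q k : visits q k -> (q < i)%N || (i < q)%N ->
    exists2 z, v q = parabola R z & between (lo a) (hi a) z = inside a k.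
  move=> vk qi; have [z [z' [ez _ zk]]] := visits_vertex vk; exists z => //.
  have ak : a != k.
    apply: contraTneq qi => ak; rewrite ak in va.
    by rewrite (visits_uniq va vk) ltnn.
  have [_ _ _ _ e] := spider_laminar ak.
  by move: zk; rewrite !inE => /orP[/eqP->|/eqP->].
have [z1 e1 <-] := ends _ _ vx ltac:(lia).
have [z2 e2 <-] := ends _ _ vy ltac:(lia).
apply: walk_side le12 _ _ e1 e2.
- move=> q q12; rewrite -va.2; have [_ _ dis] := chain_v.
  case/orP: side => /andP[s1 s2].
    by rewrite setIC; apply: dis; [lia|exact: va.1].
  have i1s : (i.+1 < i1)%N by lia.
  by apply: dis; [lia|have := vy.1; lia].
- move=> q q12; have qm : (q < m)%N by have := vy.1; lia.
  have [/(alt_v qm)[j ej]|oq] := eqVneq (odd q) b.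
    by have [z [_ [ez _ _]]] := visits_vertex (conj qm ej); exists z.
  have q0 : (0 < q)%N.
    case: q q12 {qm} oq => //.
    by rewrite leqn0 => /andP[/eqP e _]; rewrite -o1 e eqxx.
  have qm' : (q.-1 < m)%N by lia.
  have oq' : odd q.-1 = b by move: oq; rewrite -{1}(prednK q0) /=; case: odd; case: b.
  have [j ej] := (alt_v qm').2 oq'.
  by have [_ [z [_ ez _]]] := visits_vertex (conj qm' ej); exists z; rewrite -ez prednK.
Qed.

Definition visited : {set 'I_n} :=
  [set j | `[< exists2 i, (i < m)%N & edge v i = member_segment spider j >]]%SET.

Lemma visitedP j : reflect (exists i, visits i j) (j \in visited).
Proof.
rewrite inE; apply: (iffP (asboolP _)) => [[i im e]|[i [im e]]]; exists i => //.
Qed.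

(** [t] tells the direction in which the path is trapped in leg [q] from some
    visit on: backwards in time if [t] is true, forwards otherwise. *)
Definition confined (q : nat) (t : bool) := exists i a, [/\ visits i a, (a %/ h)%N = q &
  forall i' a', visits i' a' -> (if t then i' < i else i < i')%N -> (a' %/ h)%N = q].

(** Compare the two visits that witness the confinement: in either direction,
    one of the two comes within the scope of the other. *)
Lemma confined_uniq q q' t : confined q t -> confined q' t -> q = q'.
Proof.
move=> [i [a [va aq conf]]] [i' [a' [va' aq' conf']]].
have [lt|lt|e] := ltngtP i i'.
- by case: t conf conf' => conf conf'; [rewrite -aq (conf' i a)|rewrite -aq' (conf i' a')].
- by case: t conf conf' => conf conf'; [rewrite -aq' (conf i' a')|rewrite -aq (conf' i a)].
rewrite -aq -aq'; congr (_ %/ _)%N; apply/congr1.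
apply: (@member_segment_eq _ _ spider spider_disjoint _ _ (v i)).
  by rewrite -va.2; exact: segment_left.
by rewrite e -va'.2; exact: segment_left.
Qed.

(** Of the two segments, the shallower is the barrier: the deeper one is inside
    it, hence so is every visit on the same side in time. *)
Lemma two_visits_confined q : (1 < #|[set j in visited | (j %/ h)%N == q]|)%N ->
  exists t, confined q t.
Proof.
move=> /card_gt1P[a [x []]].
rewrite inE => /andP[/visitedP[i va] /eqP aq].
rewrite inE => /andP[/visitedP[k vx] /eqP xq] nax.
wlog ax : a x i k va aq vx xq nax / (a %% h < x %% h)%N => [ih|].
  have := same_leg (etrans aq (esym xq)) nax; rewrite neq_ltn => /orP[lt|lt].
    exact: (ih a x i k).
  by apply: (ih x a k i) => //; rewrite eq_sym.
have in_ax := inside_depth (etrans aq (esym xq)) ax.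
have conf i' a' : visits i' a' -> (i' < i)%N && (k < i)%N || (i < i')%N && (i < k)%N ->
    (a' %/ h)%N = q.
  move=> va' side; rewrite -aq; apply: inside_leg.
  by rewrite (one_side va va' vx side).
have [ik|ki|ik] := ltngtP i k.
- by exists false, i, a; split=> // i' a' va' ii'; apply: (conf i' a') => //; rewrite ii' ik orbT.
- by exists true, i, a; split=> // i' a' va' ii'; apply: (conf i' a') => //; rewrite ii' ki.
case/eqP: nax; apply: (@member_segment_eq _ _ spider spider_disjoint _ _ (v i)).
  by rewrite -va.2; exact: segment_left.
by rewrite ik -vx.2; exact: segment_left.
Qed.

(** Each of the [L] legs contributes at most one visit, except at most two of
    them, one per direction of confinement, which contribute up to [h]. *)
Lemma card_visited L : (n <= h * L)%N -> (#|visited| <= L + 2 * (h - 1))%N.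
Proof.
move=> nhL; have leg_lt j : (j %/ h < L)%N by rewrite ltn_divLR // (leq_trans (ltn_ord j)) // mulnC.
pose leg j := Ordinal (leg_lt j).
pose busy := [set q : 'I_L | (1 < #|[set j in visited | (j %/ h)%N == q]|)%N].
have card_busy : (#|busy| <= 2)%N.
  pose f (q : 'I_L) := `[< confined q true >].
  rewrite -card_bool -(@card_in_imset _ _ f); first exact: max_card.
  have dec (q : 'I_L) : q \in busy -> confined q (f q).
    rewrite inE => /two_visits_confined[t]; rewrite /f; case: asboolP => //.
    by case: t.
  by move=> q q' /dec cq /dec cq' e; apply/val_inj/(confined_uniq cq); rewrite e.
have leg_card (q : 'I_L) :
    (#|[set j in visited | (j %/ h)%N == q]| <= 1 + (q \in busy) * (h - 1))%N.
  rewrite inE; case: ltnP => [_|]; last by rewrite mul0n addn0.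
  rewrite mul1n subnKC //.
  rewrite -[X in (_ <= X)%N]card_ord.
  rewrite -(@card_in_imset _ _ (fun j : 'I_n => Ordinal (ltn_pmod j h_gt0))).
    exact: max_card.
  move=> a x; rewrite !inE => /andP[_ /eqP aq] /andP[_ /eqP xq] [e].
  by apply/val_inj; rewrite /= (divn_eq a h) (divn_eq x h) aq xq e.
rewrite -sum1_card (partition_big leg xpredT) //=.
have -> : (L + 2 * (h - 1) = \sum_(q < L) 1 + 2 * (h - 1))%N by rewrite sum1_card card_ord.
apply: leq_trans (_ : \sum_(q < L) (1 + (q \in busy) * (h - 1)) <= _)%N.
  apply: leq_sum => q _; apply: leq_trans (leg_card q).
  rewrite -sum1_card; apply: eq_leq; apply: eq_bigl => j.
  by rewrite !inE.
rewrite big_split /= leq_add2l -big_distrl /= leq_mul2r; apply/orP; right.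
by apply: leq_trans card_busy; rewrite -sum1_card [X in (_ <= X)%N]big_mkcond.
Qed.

End Path.
End Spider.

Lemma always_admits_upper (R : realType) (n h L k : nat) : (0 < h)%N -> (n <= h * L)%N ->
  always_admits R n k -> (k <= L + 2 * (h - 1))%N.
Proof.
move=> h0 nhL adm.
have [m [v [[chain_v [b alt_v]] <-]]] := adm _ (@spider_disjoint R n h h0) (@spider_convex R n h).
exact: (card_visited h0 chain_v alt_v nhL).
Qed.

(** * The value of p(n) *)

Lemma ceil_sqrt (R : realType) (n : nat) : (1 <= n)%N -> exists k : nat,
  [/\ ((k + 1) ^ 2 < 8 * n)%N, (8 * n <= (k + 2) ^ 2)%N &
      k%:Z = Num.ceil (Num.sqrt ((8 * n)%:R : R) - 2)].
Proof.
move=> hn; pose P k := (8 * n <= (k + 2) ^ 2)%N.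
have exP : exists k, P k by exists (8 * n)%N; rewrite /P; nia.
case: (ex_minnP exP) => k Pk mink.
have lt : ((k + 1) ^ 2 < 8 * n)%N.
  case: k Pk mink => [|k] Pk mink; first by lia.
  rewrite ltnNge; apply/negP => le; have := mink k; rewrite /P.
  by rewrite (_ : k + 2 = k.+1 + 1)%N ?le; [move=> /(_ isT); lia|lia].
exists k; split=> //; apply/esym/ceil_def; rewrite intrB -!pmulrn.
have lt_s : (k + 1)%:R < Num.sqrt (8 * n)%:R :> R.
  by rewrite -[ltLHS]ger0_norm // -sqrtr_sqr ltr_sqrt ?ltr0n -?natrX ?ltr_nat //; lia.
have s_le : Num.sqrt (8 * n)%:R <= (k + 2)%:R :> R.
  by rewrite -[leRHS]ger0_norm // -sqrtr_sqr ler_wsqrtr // -natrX ler_nat.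
by move: lt_s s_le; rewrite !natrD => lt_s s_le; apply/andP; split; lra.
Qed.

(** The product of [h] and [L] is to be maximal under [2 * h + L = k + 2], so
    [h] is an integer nearest to a quarter of [k + 2]. *)
Lemma spider_dimensions k : (1 <= k)%N -> exists h L, [/\ (0 < h)%N, (L + 2 * (h - 1) = k)%N &
  forall n, (8 * n <= (k + 2) ^ 2)%N -> (n <= h * L)%N].
Proof.
move=> k1; pose h := ((k + 3) %/ 4)%N; exists h, (k + 2 - 2 * h)%N.
have h0 : (0 < h)%N by rewrite /h; lia.
split=> //; first by rewrite /h; lia.
move=> n; have := divn_eq (k + 3) 4; rewrite -/h.
have := ltn_pmod (k + 3) (isT : 0 < 4)%N.
move: ((k + 3) %% 4)%N => r r4 e.
have ek : k = (4 * h + r - 3)%N by lia.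
by case: r r4 e ek => [|[|[|[|]]]] // _ e ->; nia.
Qed.

Theorem theorem1 (R : realType) (n : nat) (hn : (1 <= n)%N) :
  exists2 k : nat, is_p R n k &
    k%:Z = Num.ceil (Num.sqrt ((8 * n)%:R : R) - 2).
Proof.
have [k [lt_k le_k ek]] := ceil_sqrt R hn; exists k => //.
split=> [|k' adm]; first exact: always_admits_lower.
have k1 : (1 <= k)%N by nia.
have [h [L [h0 eL nhL]]] := spider_dimensions k1.
rewrite -eL; exact: always_admits_upper h0 (nhL n le_k) adm.
Qed.
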